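(* Let $p\ge 1$ be a real number and let $f$ be a consensus function on the $n$-cube $Q_n$. Then $f=\ell_p$ if and only if $f$ satisfies the Translation axiom (T) and, for any profile $\pi=(x_1,\dots,x_k)$, $$\mathbf{0}\in f(\pi)\ \text{ if and only if }\ Char_p(\pi)\le Char_p(\pi\oplus a)\ \text{ for every vertex } a \text{ of } Q_n.$$
   Context: $Q_n=(X,E)$ is the $n$-dimensional hypercube graph with vertex set $X=\{0,1\}^n$ and distance $d(u,v)=\sum_{i=1}^n|u_i-v_i|$ (Hamming distance). A profile is a finite sequence $\pi=(x_1,\dots,x_k)$ of vertices of $X$ of any length $k\ge 1$; $X^*=\bigcup_{k\ge1}X^k$ is the set of all profiles. A consensus function on $Q_n$ is a map $f:X^*\to 2^X\setminus\{\emptyset\}$. For $u,v\in X$, $u\oplus v$ denotes coordinatewise addition modulo 2, and $\pi\oplus v=(x_1\oplus v,\dots,x_k\oplus v)$. $\mathbf{0}=(0,\dots,0)$, and $\Vert u\Vert=d(\mathbf 0,u)$ is the number of ones in $u$. The $\ell_p$-function is defined by $\ell_p(\pi)=\{x\in X:\ \sum_{i=1}^k d(x,x_i)^p\text{ is minimum}\}$, the minimum being over all $x\in X$. The $p$-characteristic of a profile $\pi=(x_1,\dots,x_k)$ is $Char_p(\pi)=\sum_{i=1}^k\Vert x_i\Vert^p$. Translation (T): for every profile $\pi$ and all vertices $u,v\in X$, $u\in f(\pi)$ implies $u\oplus v\in f(\pi\oplus v)$. *)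

(* Defs.v *)
From HB Require Import structures.
From mathcomp Require Import all_boot all_order all_algebra.
From mathcomp Require Import reals exp.
Set Implicit Arguments.
Unset Strict Implicit.
Unset Printing Implicit Defensive.
Import Order.TTheory GRing.Theory Num.Theory.
Local Open Scope ring_scope.

(* bool is the two-element field, its addition being exclusive or, so the
   pointwise zmodType structure on vertices gives 0 = (0,...,0), and u + v is
   the coordinatewise sum modulo 2. *)
Notation vertex n := {ffun 'I_n -> bool}.

(* The coordinates are coerced to 0 or 1 in nat, and the difference is taken
   in int, so this is the sum of the |u_i - v_i|, not a truncated difference. *)
Definition dist n (u v : vertex n) : nat := (\sum_(i < n) `|u i - v i|)%N.

Definition norm n (u : vertex n) : nat := dist 0 u.

Record profile n := Profile {
  profile_seq :> seq (vertex n);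
  profile_nonempty : (0 < size profile_seq)%N }.

HB.instance Definition _ n := [isSub for @profile_seq n].

Lemma translate_nonempty n (pi : profile n) (v : vertex n) :
  (0 < size [seq (x + v)%R | x <- pi])%N.
Proof. by rewrite size_map profile_nonempty. Qed.

Definition translate n (pi : profile n) (v : vertex n) : profile n :=
  Profile (translate_nonempty pi v).

Definition consensus_function n (f : profile n -> {set vertex n}) : Prop :=
  forall pi : profile n, f pi != set0.

Definition ell (R : realType) (p : R) n (pi : profile n) : {set vertex n} :=
  [set x : vertex n | [forall y : vertex n,
     \sum_(z <- pi) (dist x z)%:R `^ p <= \sum_(z <- pi) (dist y z)%:R `^ p]].

Definition Char (R : realType) (p : R) n (pi : profile n) : R :=
  \sum_(x <- pi) (norm x)%:R `^ p.

Definition translation_axiom n (f : profile n -> {set vertex n}) : Prop :=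
  forall (pi : profile n) (u v : vertex n),
    u \in f pi -> u + v \in f (translate pi v).

(* Main.v *)
Require Import Defs.
From mathcomp Require Import all_boot all_order all_algebra.
From mathcomp Require Import boolp.
From mathcomp Require Import reals exp.
Import GRing.Theory.
Local Open Scope ring_scope.

(** Translations are isometries of the cube, and every vertex is its own
    opposite, so the distance from [x] to [z] is the norm of [z + x].  The
    objective function that [ell] minimizes therefore takes at [x] the value
    [Char p (translate pi x)] ([sum_dist_pow]).  Both properties of [ell] are
    read off from this: the condition on [0] compares that value at [0] with
    its value at every other vertex, and the translation axiom holds because
    translating the profile translates the objective function.

    Conversely, a function satisfying the translation axiom is determined by
    the profiles whose image contains [0]: since translating by [x] sends [x]
    to [0], [x] is in [f pi] exactly when [0] is in [f (translate pi x)].  As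
    [f] and [ell] satisfy the axiom and agree on when [0] is selected, they
    coincide ([translation_eq]). *)

Lemma addvv {n} (x : vertex n) : x + x = 0.
Proof. by apply/ffunP => i; rewrite !ffunE; case: (x i). Qed.

Lemma dist_translate {n} (u v w : vertex n) : dist (u + w) (v + w) = dist u v.
Proof.
apply: eq_bigr => i _; rewrite !ffunE.
by case: (u i); case: (v i); case: (w i).
Qed.

Lemma dist_norm {n} (x z : vertex n) : dist x z = norm (z + x).
Proof. by rewrite -(dist_translate x z x) addvv. Qed.

Lemma translate0 {n} (pi : profile n) : translate pi 0 = pi.
Proof.
apply: val_inj => /=; rewrite -[RHS]map_id.
by apply: eq_map => x; rewrite addr0.
Qed.

Lemma translateD {n} (pi : profile n) (u v : vertex n) :
  translate (translate pi u) v = translate pi (u + v).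
Proof.
apply: val_inj; rewrite /= -map_comp.
by apply: eq_map => x /=; rewrite addrA.
Qed.

(** This turns the minimization over vertices that defines [ell] into a
    comparison of the characteristics of the translates of [pi]. *)
Lemma sum_dist_pow {R : realType} (p : R) {n} (pi : profile n) (x : vertex n) :
  \sum_(z <- pi) (dist x z)%:R `^ p = Char p (translate pi x).
Proof.
by rewrite /Char big_map; apply: eq_bigr => z _; rewrite dist_norm.
Qed.

Lemma ellP {R : realType} (p : R) {n} (pi : profile n) (x : vertex n) :
  x \in ell p pi <->
  forall y, Char p (translate pi x) <= Char p (translate pi y).
Proof.
rewrite inE; split=> [/forallP h y | h]; first by rewrite -!sum_dist_pow.
by apply/forallP => y; rewrite !sum_dist_pow.
Qed.

Lemma ell_translation {R : realType} (p : R) {n} :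
  translation_axiom (@ell R p n).
Proof.
move=> pi u v /ellP h; apply/ellP => y; rewrite !translateD.
(* The two copies of [v] cancel, one from the profile and one from [u + v]. *)
by rewrite addrCA addvv addr0.
Qed.

Lemma mem0_ell {R : realType} (p : R) {n} (pi : profile n) :
  0 \in ell p pi <-> forall a, Char p pi <= Char p (translate pi a).
Proof. by rewrite ellP translate0. Qed.

(** Translating by [x] moves [x] to [0], and doing so twice restores the
    profile, which is why one-sided implications in the axiom suffice for an
    equivalence. *)
Lemma translation_mem {n} {f : profile n -> {set vertex n}} (pi : profile n)
    (x : vertex n) :
  translation_axiom f -> x \in f pi <-> 0 \in f (translate pi x).
Proof.
move=> fT; split=> [/fT-/(_ x) | /fT-/(_ x)]; first by rewrite addvv.
by rewrite translateD addvv translate0 add0r.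
Qed.

(** By [translation_mem], membership of any vertex is membership of [0] for a
    translated profile, so agreement at [0] over all profiles is enough. *)
Lemma translation_eq {n} (f g : profile n -> {set vertex n}) :
  translation_axiom f -> translation_axiom g ->
  (forall pi, 0 \in f pi <-> 0 \in g pi) -> f = g.
Proof.
move=> fT gT fg; apply: funext => pi; apply/setP => x; apply/idP/idP => h.
  by apply/(translation_mem pi x gT)/fg/(translation_mem pi x fT).
by apply/(translation_mem pi x fT)/fg/(translation_mem pi x gT).
Qed.

Theorem corollary3 (R : realType) (p : R) (hp : 1 <= p) (n : nat)
    (f : profile n -> {set vertex n}) (hf : consensus_function f) :
  f = @ell R p n <->
  translation_axiom f /\
  (forall pi : profile n,
     0 \in f pi <->
     (forall a : vertex n, Char p pi <= Char p (translate pi a))).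
Proof.
split=> [-> | [fT f0]].
  by split; [exact: ell_translation | exact: mem0_ell].
apply: translation_eq => // [|pi]; first exact: ell_translation.
by rewrite f0 mem0_ell.
Qed.
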